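(* Let $p$ be an odd prime and let $G$ be a group with $|G|=p^n$ and $|Z(G)|=p^{n-2}$. Let $\zeta(G,G)$ be the commuting graph of $G$ on the vertex set $G$, and write $\Omega_1=Z(G)$. For every vertex $u$ of $\zeta(G,G)$, the detour eccentricity is $$ecc_D(u)=\begin{cases} p^3-p^2+p-1 & \text{if } n=3 \text{ and } u\in\Omega_1,\\ p^n-1 & \text{otherwise.}\end{cases}$$ Moreover, if $n=3$ then $rad_D(\zeta(G,G))=p^3-p^2+p-1$ and $diam_D(\zeta(G,G))=p^3-1$; and for all $n>3$, $rad_D(\zeta(G,G))=diam_D(\zeta(G,G))=p^n-1$.
   Context: $Z(G)$ is the center of $G$. The commuting graph $\zeta(G,V)$, for $V\subseteq G$, is the simple graph with vertex set $V$ in which two distinct vertices are adjacent if and only if they commute in $G$. For vertices $u,w$ of a connected graph with vertex set $V$, the detour distance $D(u,w)$ is the length (number of edges) of a longest path (no repeated vertices) between $u$ and $w$. The detour eccentricity is $ecc_D(u)=\max\{D(u,w): w\in V\}$; the detour radius $rad_D$ is $\min\{ecc_D(u): u\in V\}$ and the detour diameter $diam_D$ is $\max\{ecc_D(u): u\in V\}$. *)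

(* Defs.v *)
From mathcomp Require Import all_boot all_order all_fingroup all_solvable.

Set Implicit Arguments.
Unset Strict Implicit.
Unset Printing Implicit Defensive.

Record sgraph (T : finType) := SGraph {
  vertices : {set T};
  adj : rel T;
  adj_sym : symmetric adj;
  adj_irr : irreflexive adj;
  adj_vertices : forall x y, adj x y -> (x \in vertices) && (y \in vertices)
}.

Definition simple_path (T : finType) (g : sgraph T) (u : T) (s : seq T) (w : T) :=
  [&& path (adj g) u s, uniq (u :: s) & last u s == w].

(* A path on the vertices u :: s has size s edges, hence fewer than the number
   of vertices.  The value is 0 by convention when no path joins u to w, which
   does not happen in a connected graph. *)
Definition detour_dist (T : finType) (g : sgraph T) (u w : T) : nat :=
  \max_(l < #|vertices g| | [exists s : l.-tuple T, simple_path g u s w]) l.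

Definition detour_ecc (T : finType) (g : sgraph T) (u : T) : nat :=
  \max_(w in vertices g) detour_dist g u w.

Definition detour_diam (T : finType) (g : sgraph T) : nat :=
  \max_(u in vertices g) detour_ecc g u.

(* minn has no neutral element on nat; starting the iteration from the largest
   eccentricity does not affect the minimum over a nonempty vertex set. *)
Definition detour_rad (T : finType) (g : sgraph T) : nat :=
  \big[minn/detour_diam g]_(u in vertices g) detour_ecc g u.

Section CommutingGraph.

Variables (gT : finGroupType) (V : {set gT}).

Definition commuting_adj : rel gT :=
  fun x y => [&& x \in V, y \in V, x != y & (x * y == y * x)%g].

Fact commuting_adj_sym : symmetric commuting_adj.
Proof.
by move=> x y; rewrite /commuting_adj andbCA (eq_sym x) (eq_sym (x * y)%g).
Qed.

Fact commuting_adj_irr : irreflexive commuting_adj.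
Proof. by move=> x; rewrite /commuting_adj eqxx !andbF. Qed.

Fact commuting_adj_vertices x y :
  commuting_adj x y -> (x \in V) && (y \in V).
Proof. by case/and4P=> -> ->. Qed.

(* Commuting in a subgroup containing V is the same as commuting in gT, so the
   ambient group is not a parameter. *)
Definition commuting_graph : sgraph gT :=
  SGraph commuting_adj_sym commuting_adj_irr commuting_adj_vertices.

End CommutingGraph.

(* Main.v *)
(* Let Z be the center and N = G \ Z.  Since |G : Z| = p^2, the centralizer of
   any x in N has index p and is abelian, so the sets C(x) \ Z are p + 1 disjoint
   cliques of size p^(n-1) - p^(n-2) covering N, with no edge between two of
   them, while Z is adjacent to everything.  A path changes clique only through
   Z; alternating central elements with entire cliques gives a Hamiltonian path
   from u as soon as enough central elements are available, which fails only
   when |Z| = p and u is itself central: then at most p of the p + 1 cliques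
   can be visited, and p of them can be visited entirely. *)

Require Import Defs.
From mathcomp Require Import all_boot all_order all_fingroup all_solvable.
From mathcomp Require Import zify.

Set Implicit Arguments.
Unset Strict Implicit.
Unset Printing Implicit Defensive.

(** * Detour eccentricity, radius and diameter of an arbitrary graph *)

Section Detour.

Variables (T : finType) (g : sgraph T).

Lemma path_adj_vertices u s :
  u \in vertices g -> path (adj g) u s -> {subset u :: s <= vertices g}.
Proof.
elim: s u => [|y s IHs] u uV /= => [_ x|/andP[/adj_vertices/andP[_ yV] /(IHs _ yV) sV] x].
  by rewrite inE => /eqP->.
by rewrite in_cons => /predU1P[->|/sV].
Qed.

Lemma detour_ecc_ge u s :
  u \in vertices g -> path (adj g) u s -> uniq (u :: s) ->
  size s <= detour_ecc g u.
Proof.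
move=> uV pus Uus; have sV := path_adj_vertices uV pus.
have lt_s: size s < #|vertices g|.
  by rewrite cardE (@uniq_leq_size _ (u :: s)) // => x /sV; rewrite mem_enum.
apply: (@bigmax_sup _ (last u s)); first exact/sV/mem_last.
apply: (@bigmax_sup _ (Ordinal lt_s)) => //=.
by apply/existsP; exists (in_tuple s); rewrite /simple_path pus Uus eqxx.
Qed.

Lemma detour_ecc_le u m :
  (forall s, path (adj g) u s -> uniq (u :: s) -> size s <= m) ->
  detour_ecc g u <= m.
Proof.
move=> le_m; apply/bigmax_leqP => w _; apply/bigmax_leqP => l /existsP[s].
by case/and3P=> /le_m/[apply]; rewrite size_tuple.
Qed.

Lemma detour_ecc_le_card u :
  u \in vertices g -> detour_ecc g u <= #|vertices g|.-1.
Proof.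
move=> uV; apply: detour_ecc_le => s /(path_adj_vertices uV) sV Uus.
have: size (u :: s) <= #|vertices g|.
  by rewrite cardE (@uniq_leq_size _ (u :: s)) // => x /sV; rewrite mem_enum.
by move=> /=; lia.
Qed.

Lemma detour_diam_eq u m :
    u \in vertices g -> detour_ecc g u = m ->
    {in vertices g, forall w, detour_ecc g w <= m} ->
  detour_diam g = m.
Proof.
move=> uV eum le_m; apply/eqP; rewrite eqn_leq; apply/andP; split.
  exact/bigmax_leqP.
by rewrite -eum; apply: (@bigmax_sup _ u).
Qed.

Lemma detour_rad_eq u m :
    u \in vertices g -> detour_ecc g u = m ->
    {in vertices g, forall w, m <= detour_ecc g w} ->
  detour_rad g = m.
Proof.
move=> uV eum ge_m; apply/eqP; rewrite eqn_leq /detour_rad -minEnat -leEnat.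
apply/andP; split; first by
  apply: (@Order.TotalTheory.bigmin_inf _ _ _ _ u) => //; rewrite eum.
apply/Order.TotalTheory.bigmin_geP; split=> //.
(* The bound must also hold for the initial value [detour_diam g], which dominates the eccentricity
   of [u]. *)
by rewrite leEnat (@bigmax_sup _ u) // eum.
Qed.

End Detour.

(** * Interleaving connecting elements with cliques *)

Section Weave.

Variable T : eqType.
Implicit Types (zs s : seq T) (bs : seq (seq T)) (P : pred T) (r : rel T).

(** Neither list is truncated when the other runs out, so [perm_weave] needs no condition on the
    sizes. *)
Fixpoint weave zs bs : seq T :=
  match bs, zs with
  | b :: bs', z :: zs' => z :: b ++ weave zs' bs'
  | [::], _ => zs
  | _, [::] => flatten bs
  end.

Lemma perm_weave zs bs : perm_eq (weave zs bs) (zs ++ flatten bs).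
Proof.
elim: bs zs => [|b bs IHbs] [|z zs] //=; first by rewrite cats0.
rewrite perm_cons (perm_trans (_ : perm_eq _ (b ++ zs ++ flatten bs))) //.
  by rewrite perm_cat2l.
by rewrite !catA perm_cat2r perm_catC.
Qed.

(** With at least as many connectors as blocks, each block is directly preceded by a connector,
    which is related to everything. A nonempty weave then starts with a connector, so [x] is
    arbitrary; this is also what lets the induction restart after each block. *)
Lemma path_weave P r x zs bs :
    (forall z y, P z -> r z y && r y z) ->
    all P zs -> all (pairwise r) bs -> size bs <= size zs ->
  path r x (weave zs bs).
Proof.
move=> rP; elim: bs zs x => [|b bs IHbs] zs x.
  move=> Pzs _ _; case: zs Pzs => //= z zs /andP[Pz Pzs].
  have [_ ->] := andP (rP z x Pz).
  elim: zs z Pz Pzs => //= y zs IHzs z Pz /andP[Py Pzs].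
  by have [-> _] := andP (rP z y Pz); apply: IHzs.
case: zs => // z zs /= /andP[Pz Pzs] /andP[rb rbs] lebz.
have [_ ->] := andP (rP z x Pz); rewrite cat_path IHbs // andbT.
apply: (@pairwise_sorted _ r (z :: b)); rewrite /= rb andbT.
by apply/allP=> y _; have [] := andP (rP z y Pz).
Qed.

(* A path can only leave a class, i.e. a fibre of f, through an element of P. *)
Lemma size_undup_classes (U : eqType) (f : T -> U) P r x s :
    (forall y z, r y z -> ~~ P y -> ~~ P z -> f y = f z) ->
    path r x s ->
  size (undup [seq f y | y <- x :: s & ~~ P y]) <= count P (x :: s) + ~~ P x.
Proof.
move=> rf; elim: s x => [|y s IHs] x; first by rewrite /=; case: (P x).
move=> /= /andP[rxy /IHs]; rewrite -/(path _ _ _) /=.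
case Px: (P x) => /=; case Py: (P y) => /=; try by lia.
  by case: ifP => /= _; lia.
have ->: f x = f y by apply: (rf _ _ rxy); rewrite ?Px ?Py.
by rewrite inE eqxx /=; lia.
Qed.

End Weave.

(** * Enumerating a family of disjoint sets *)

Section TrivIset.

Variables (T : finType) (L : {set {set T}}).

Lemma mem_flatten_enum x :
  (x \in flatten [seq enum A | A : {set T} in L]) = (x \in cover L).
Proof.
apply/flatten_imageP/bigcupP => -[A LA xA]; exists A => //;
  by rewrite mem_enum in xA *.
Qed.

Lemma uniq_flatten_enum :
  trivIset L -> uniq (flatten [seq enum A | A : {set T} in L]).
Proof.
move=> /trivIsetP tiL; have: {subset enum L <= L} by move=> A; rewrite mem_enum.
rewrite /image_mem; elim: (enum L) (enum_uniq L) => //= A s IHs /andP[sA Us] sL.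
rewrite cat_uniq enum_uniq IHs ?andbT //=; last first.
  by move=> B sB; rewrite sL // in_cons sB orbT.
apply/hasPn => x /flatten_mapP[B sB]; rewrite !mem_enum => xB.
have LB: B \in L by rewrite sL // in_cons sB orbT.
have /tiL/(_ LB): A \in L by rewrite sL ?mem_head.
have neqAB: A != B by apply: contraNneq sA => ->.
by move=> /(_ neqAB)/disjointFl ->.
Qed.

End TrivIset.

(** * Paths in commuting graphs *)

Local Open Scope group_scope.

(* Vacuously true outside V, so that central elements of V are related to the
   whole type, as path_weave requires. *)
Definition commute_in (gT : finGroupType) (V : {set gT}) (x y : gT) :=
  (x \in V) && (y \in V) ==> (x * y == y * x).

Section CommuteIn.

Variables (gT : finGroupType) (V : {set gT}).

Lemma commute_in_sym : symmetric (commute_in V).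
Proof. by move=> x y; rewrite /commute_in andbC eq_sym. Qed.

Lemma pairwise_commute_in (s : seq gT) :
  {in s &, forall x y, commute_in V x y} -> pairwise (commute_in V) s.
Proof.
move=> cs; rewrite pairwise_all2rel => [|x|]; [exact/allrelP| |exact: commute_in_sym].
by rewrite /commute_in eqxx implybT.
Qed.

(** Adjacency also demands distinct endpoints, which [commute_in] does not record; [uniq] provides
    them. *)
Lemma path_commuting_graph u s :
    uniq (u :: s) -> {subset u :: s <= V} -> path (commute_in V) u s ->
  path (adj (commuting_graph V)) u s.
Proof.
elim: s u => //= y s IHs u /andP[us Us] sV /andP[+ cs].
have ysV: {subset y :: s <= V} by move=> z sz; rewrite sV // in_cons sz orbT.
move: us; rewrite in_cons negb_or => /andP[neq_uy _].
rewrite IHs // andbT /commute_in /commuting_adj sV ?mem_head //.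
by rewrite ysV ?mem_head // neq_uy.
Qed.

End CommuteIn.

(** * The noncentral elements, partitioned by their centralizers *)

Section CentralByPSquare.

Variables (gT : finGroupType) (G : {group gT}) (p k : nat).
Hypotheses (p_prime : prime p).
Hypotheses (oG : #|G| = (p ^ k.+2)%N) (oZ : #|'Z(G)| = (p ^ k)%N).

Let m := (p ^ k.+1 - p ^ k)%N.
Let block x := 'C_G[x] :\: 'Z(G).
Let N := G :\: 'Z(G).
Let blocks := block @: N.

Let p_gt1 : 1 < p. Proof. exact: prime_gt1. Qed.

Lemma card_noncentral_eq : (p ^ k.+2 - p ^ k)%N = (p.+1 * m)%N.
Proof. by rewrite /m mulnBr !expnS; nia. Qed.

(** By Lagrange the order is a power of [p], and only one exponent lies strictly between [k] and
    [k.+2]. *)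
Lemma card_between_center (A : {group gT}) :
  'Z(G) \proper A -> A \proper G -> #|A| = (p ^ k.+1)%N.
Proof.
move=> ltZA ltAG; have := cardSg (proper_sub ltAG).
rewrite oG => /(dvdn_pfactor _ _ p_prime)[j _ oA].
have ltkj: p ^ k < p ^ j by rewrite -oZ -oA proper_card.
have ltjk: p ^ j < p ^ k.+2 by rewrite -oG -oA proper_card.
rewrite !ltn_exp2l // in ltkj ltjk.
by rewrite oA; congr (p ^ _)%N; lia.
Qed.

Lemma mem_block x : x \in N -> x \in block x.
Proof. by rewrite !in_setD in_setI cent1id andbT. Qed.

Lemma center_sub_subcent1 x : x \in G -> 'Z(G) \subset 'C_G[x].
Proof.
move=> Gx; rewrite subsetI center_sub sub_cent1 (subsetP _ _ Gx) //.
by rewrite centsC subsetIr.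
Qed.

Lemma card_subcent1 x : x \in N -> #|'C_G[x]| = (p ^ k.+1)%N.
Proof.
rewrite inE => /andP[Zx Gx]; apply: card_between_center.
  apply/properP; split; first exact: center_sub_subcent1.
  by exists x; rewrite // inE Gx cent1id.
apply/properP; split; first exact: subsetIl.
have /subsetPn[y Gy cxy]: ~~ (G \subset 'C[x]).
  by apply: contra Zx; rewrite inE Gx -sub_cent1.
by exists y; rewrite // inE Gy.
Qed.

(** The center of the centralizer contains both ['Z(G)] and the noncentral [x], so it too lies
    strictly between ['Z(G)] and [G]. It thus has the same order as the centralizer and fills it. *)
Lemma abelian_subcent1 x : x \in N -> abelian 'C_G[x].
Proof.
move=> Nx; have := Nx; rewrite inE => /andP[Zx Gx].
have ltCG: 'C_G[x] \proper G.
  by rewrite properEcard subsetIl /= card_subcent1 // oG ltn_exp2l.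
have sZC: 'Z('C_G[x]) \subset 'C_G[x] := center_sub _.
have oZC: #|'Z('C_G[x])| = (p ^ k.+1)%N.
  apply: card_between_center; last exact: sub_proper_trans sZC ltCG.
  apply/properP; split.
    rewrite subsetI center_sub_subcent1 //=.
    by rewrite (subset_trans (subsetIr _ _)) // centS ?subsetIl.
  by exists x => //; rewrite !in_setI Gx cent1id -sub_cent1 subsetIr.
have /eqP <-: 'Z('C_G[x]) == 'C_G[x] by rewrite eqEcard sZC oZC card_subcent1 /=.
exact: center_abelian.
Qed.

(** As ['C_G[x]] is abelian and contains [y], it lies in ['C_G[y]], and the two have equal order. *)
Lemma eq_block x y : x \in N -> y \in block x -> block y = block x.
Proof.
move=> Nx; rewrite in_setD in_setI => /and3P[Zy Gy cxy].
have Ny: y \in N by rewrite inE Zy.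
suff /eqP defC: 'C_G[x] == 'C_G[y] by rewrite /block defC.
rewrite eqEcard !card_subcent1 // leqnn andbT subsetI subsetIl /= sub_cent1.
by apply: (subsetP (abelian_subcent1 Nx)); rewrite inE Gy.
Qed.

Lemma card_block x : x \in N -> #|block x| = m.
Proof.
move=> Nx; have := Nx; rewrite inE => /andP[_ Gx].
by rewrite cardsD (setIidPr (center_sub_subcent1 Gx)) card_subcent1 // oZ.
Qed.

Lemma sub_block x : block x \subset N.
Proof. by rewrite setSD ?subsetIl. Qed.

Lemma commute_blocks A :
  A \in blocks -> {in A &, forall x y, commute_in G x y}.
Proof.
case/imsetP=> z Nz -> x y; rewrite !in_setD => /andP[_ Cx] /andP[_ Cy].
by apply/implyP=> _; apply/eqP/(centsP (abelian_subcent1 Nz)).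
Qed.

Lemma partition_blocks : partition blocks N.
Proof.
apply/and3P; split.
- rewrite eqEsubset; apply/andP; split; apply/subsetP => x.
    by case/bigcupP=> A /imsetP[y _ ->] /(subsetP (sub_block y)).
  by move=> Nx; apply/bigcupP; exists (block x); rewrite ?imset_f ?mem_block.
- apply/trivIsetP => A B /imsetP[x Nx ->] /imsetP[y Ny ->].
  apply: contraNT => /pred0Pn[z /andP[zx zy]].
  by rewrite -(eq_block Nx zx) (eq_block Ny zy).
by apply/imsetP=> -[x /mem_block + b0]; rewrite -b0 inE.
Qed.

Lemma card_blocks : #|blocks| = p.+1.
Proof.
have unif: {in blocks, forall A : {set gT}, #|A| = m}.
  by move=> A /imsetP[x Nx ->]; apply: card_block.
have := card_uniform_partition unif partition_blocks.
rewrite cardsD (setIidPr (center_sub G)) oG oZ => eq_card.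
have m_gt0: 0 < m by rewrite subn_gt0 ltn_exp2l.
by apply/eqP; rewrite -(eqn_pmul2r m_gt0) -eq_card card_noncentral_eq.
Qed.

Lemma trivIset_blocks (L : {set {set gT}}) : L \subset blocks -> trivIset L.
Proof. by move=> sLb; apply: trivIsetS sLb _; case/and3P: partition_blocks. Qed.

Lemma disjoint_cover_blocks A (L : {set {set gT}}) :
  A \in blocks -> L \subset blocks :\ A -> [disjoint A & cover L].
Proof.
move=> bA sLb; apply: bigcup_disjoint => B /(subsetP sLb)/setD1P[neqBA bB].
by have /and3P[_ /trivIsetP tib _] := partition_blocks; apply: tib; rewrite // eq_sym.
Qed.

(** * Long paths and the eccentricities *)

Lemma commute_in_center z x : z \in 'Z(G) -> commute_in G z x.
Proof. by case/setIP=> _ /centP cz; apply/implyP=> /andP[_ /cz/eqP]. Qed.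

(** The path runs from [u] through [B], at no cost in central elements since [u] commutes with [B],
    and then weaves the blocks of [L] with the central elements of [W]. *)
Lemma long_path u (B W : {set gT}) (L : {set {set gT}}) :
    u \in G -> B \subset N -> W \subset 'Z(G) -> L \subset blocks ->
    {in u |: B &, forall x y, commute_in G x y} ->
    u \notin B :|: W :|: cover L -> [disjoint B & cover L] ->
    #|L| <= #|W| ->
  #|B| + #|W| + #|L| * m <= detour_ecc (commuting_graph G) u.
Proof.
move=> Gu sBN sWZ sLb cB u_new dBL leLW.
set s := enum B ++ weave (enum W) [seq enum A | A : {set gT} in L].
have mem_s: s =i B :|: W :|: cover L.
  move=> x; rewrite mem_cat (perm_mem (perm_weave _ _)) mem_cat !mem_enum.
  by rewrite mem_flatten_enum !inE orbA.
have sLN: cover L \subset N.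
  apply/bigcupsP => A /(subsetP sLb)/imsetP[x _ ->]; exact: sub_block.
have dWN: [disjoint W & N].
  rewrite disjoints_subset; apply/subsetP => x /(subsetP sWZ) Zx.
  by rewrite in_setC in_setD Zx.
have dWL: [disjoint W & cover L] by apply: disjointWr dWN.
have size_s: size s = #|B| + #|W| + #|L| * m.
  rewrite size_cat (perm_size (perm_weave _ _)) size_cat -!cardE size_flatten.
  rewrite -addnA; congr (_ + (_ + _)).
  rewrite cardE /shape /image_mem -map_comp.
  have: {subset enum L <= blocks} by move=> A; rewrite mem_enum => /(subsetP sLb).
  elim: (enum L) => //= A l IHl sl.
  rewrite mulSn IHl; last by move=> D lD; rewrite sl // in_cons lD orbT.
  by have /imsetP[x Nx ->] := sl A (mem_head _ _); rewrite -cardE card_block.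
have Us: uniq (u :: s).
  rewrite /= mem_s u_new cat_uniq enum_uniq (perm_uniq (perm_weave _ _)) /=.
  rewrite cat_uniq enum_uniq uniq_flatten_enum ?trivIset_blocks // andbT /=.
  apply/andP; split; apply/hasPn => x.
    rewrite (perm_mem (perm_weave _ _)) mem_cat !mem_enum mem_flatten_enum.
    case/orP=> [Wx|Lx]; last by rewrite (disjointFl dBL).
    by apply: contraFN (disjointFr dWN Wx); apply: (subsetP sBN).
  by rewrite mem_flatten_enum !mem_enum => Lx; rewrite (disjointFl dWL).
rewrite -size_s; apply: detour_ecc_ge => //; apply: path_commuting_graph => //.
  move=> x; rewrite in_cons => /predU1P[-> //|].
  rewrite mem_s !in_setU => /orP[/orP[/(subsetP sBN)/setDP[] //|]|].
    by case/(subsetP sWZ)/setIP.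
  by case/(subsetP sLN)/setDP.
rewrite cat_path; apply/andP; split.
  apply: (@pairwise_sorted _ _ (u :: enum B)); apply: pairwise_commute_in.
  by move=> x y; rewrite !in_cons !mem_enum -!in_setU1 => uBx uBy; apply: cB.
apply: (@path_weave _ (mem 'Z(G))).
- by move=> z y Zz; rewrite (commute_in_sym _ y) andbb commute_in_center.
- by apply/allP => z; rewrite mem_enum => /(subsetP sWZ).
- apply/allP => _ /mapP[A + ->]; rewrite mem_enum => /(subsetP sLb) bA.
  by apply: pairwise_commute_in => x y; rewrite !mem_enum; apply: commute_blocks.
by rewrite size_image -cardE.
Qed.

Lemma detour_ecc_noncentral u : 0 < k -> u \in N ->
  detour_ecc (commuting_graph G) u = (p ^ k.+2 - 1)%N.
Proof.
move=> k_gt0 Nu; have /setDP[Gu Zu] := Nu.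
apply/eqP; rewrite eqn_leq; apply/andP; split.
  by rewrite -oG subn1; apply: (@detour_ecc_le_card _ (commuting_graph G)).
have b_u := imset_f block Nu; have uu := mem_block Nu.
have dL : [disjoint block u & cover (blocks :\ block u)] by apply: disjoint_cover_blocks.
have le_pk: p <= p ^ k by rewrite -{1}[p]expn1 leq_exp2l.
have defm := cardsD1 u (block u); rewrite uu card_block // in defm.
have := cardsD1 (block u) blocks; rewrite b_u card_blocks add1n => -[defp].
have ->: (p ^ k.+2 - 1 = #|block u :\ u| + #|'Z(G)| + #|blocks :\ block u| * m)%N.
  have lek: p ^ k <= p ^ k.+2 by rewrite leq_exp2l //; lia.
  by have := card_noncentral_eq; rewrite -defp oZ mulSn; lia.
(* The path first finishes the block of [u]; the [p] other blocks need [p] connectors, and there are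
   [p ^ k] of them. *)
apply: long_path => //; last by rewrite -defp oZ.
- exact: subset_trans (subD1set _ _) (sub_block u).
- exact: subD1set.
- by rewrite setD1K //; exact: commute_blocks.
- by rewrite !in_setU in_setD1 eqxx (negPf Zu) (disjointFr dL uu).
exact: disjointWl (subD1set _ _) dL.
Qed.

Lemma detour_ecc_central u : 1 < k -> u \in 'Z(G) ->
  detour_ecc (commuting_graph G) u = (p ^ k.+2 - 1)%N.
Proof.
move=> k_gt1 Zu; have /setIP[Gu _] := Zu.
apply/eqP; rewrite eqn_leq; apply/andP; split.
  by rewrite -oG subn1; apply: (@detour_ecc_le_card _ (commuting_graph G)).
have defz := cardsD1 u 'Z(G); rewrite Zu oZ in defz.
have ->: (p ^ k.+2 - 1 = #|@set0 gT| + #|'Z(G) :\ u| + #|blocks| * m)%N.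
  have lek: p ^ k <= p ^ k.+2 by rewrite leq_exp2l //; lia.
  by have := card_noncentral_eq; rewrite card_blocks cards0; lia.
apply: long_path => //.
- exact: sub0set.
- exact: subD1set.
- by rewrite setU0 => x y /set1P-> /set1P->; rewrite /commute_in eqxx implybT.
- by rewrite !in_setU in_set0 in_setD1 eqxx (cover_partition partition_blocks) in_setD Zu.
- by rewrite -setI_eq0 set0I.
(* All [p.+1] blocks are woven, with [p ^ k - 1] connectors left besides [u]; [p ^ 2 - 1] would do,
   being [(p - 1) * (p + 1)]. *)
have: p ^ 2 <= p ^ k by rewrite leq_exp2l.
by rewrite card_blocks; nia.
Qed.

(** From [u] the path enters a first block [A] directly, and the [p.-1] other central elements lead
    to [p.-1] further blocks. One block, [B], is left out. *)
Lemma detour_ecc_central1_ge u : k = 1%N -> u \in 'Z(G) ->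
  p ^ 3 - p ^ 2 + p - 1 <= detour_ecc (commuting_graph G) u.
Proof.
move=> k1 Zu; have /setIP[Gu _] := Zu.
have /card_gt0P[A bA]: 0 < #|blocks| by rewrite card_blocks.
have := cardsD1 A blocks; rewrite bA card_blocks add1n => -[defp].
have /card_gt0P[B]: 0 < #|blocks :\ A| by rewrite -defp ltnW.
move=> B_; have := cardsD1 B (blocks :\ A); rewrite B_ -defp add1n => defp1.
have := cardsD1 u 'Z(G); rewrite Zu oZ k1 expn1 add1n => defp2.
have defL: #|blocks :\ A :\ B| = p.-1 by rewrite defp1.
have defz: #|'Z(G) :\ u| = p.-1 by rewrite defp2.
have /setD1P[_ bB] := B_; have sLb: blocks :\ A :\ B \subset blocks.
  by rewrite (subset_trans (subD1set _ _)) ?subD1set.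
have sAN: A \subset N by case/imsetP: bA => x _ ->; apply: sub_block.
have eA: #|A| = m by case/imsetP: bA => x Nx ->; apply: card_block.
have ->: (p ^ 3 - p ^ 2 + p - 1 = #|A| + #|'Z(G) :\ u| + #|blocks :\ A :\ B| * m)%N.
  rewrite eA defz defL /m k1; case: (p) p_gt1 => // q _ /=.
  have ->: (q.+1 ^ 2 - q.+1 ^ 1 = q * q.+1)%N by nia.
  by nia.
apply: long_path => //.
- exact: subD1set.
- move=> x y /setU1P[->|xA] /setU1P[->|yA]; last exact: commute_blocks xA yA.
  + by rewrite /commute_in eqxx implybT.
  + by rewrite commute_in_center.
  by rewrite commute_in_sym commute_in_center.
- rewrite !in_setU in_setD1 eqxx orbF.
  have sLN: cover (blocks :\ A :\ B) \subset N.
    by apply/bigcupsP => C /(subsetP sLb)/imsetP[x _ ->]; apply: sub_block.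
  have: u \notin N by rewrite /N in_setD Zu.
  by apply: contra => /orP[/(subsetP sAN)|/(subsetP sLN)].
- by apply: disjoint_cover_blocks => //; exact: subD1set.
by rewrite defz defL.
Qed.

(** A path from [u] meets at most as many blocks as central elements, hence at most [p], and so
    misses one of the [p.+1] blocks entirely. Its vertices lie in the complement of that block, and
    its edges are one fewer. *)
Lemma detour_ecc_central1_le u : k = 1%N -> u \in 'Z(G) ->
  detour_ecc (commuting_graph G) u <= p ^ 3 - p ^ 2 + p - 1.
Proof.
move=> k1 Zu; have /setIP[Gu _] := Zu.
apply: detour_ecc_le => s pus Us.
have sG := @path_adj_vertices _ (commuting_graph G) u s Gu pus.
set cl := undup [seq block x | x <- u :: s & x \notin 'Z(G)].
have lecl: size cl <= p.
  have leZ: count (mem 'Z(G)) (u :: s) <= p.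
    rewrite -size_filter -[p]expn1 -k1 -oZ cardE uniq_leq_size ?filter_uniq // => x.
    by rewrite mem_filter mem_enum => /andP[].
  apply: leq_trans leZ.
  have := @size_undup_classes _ _ block (mem 'Z(G)) _ _ _ _ pus.
  (* A central start removes the extra class allowed to a noncentral one. *)
  rewrite [mem _ u]Zu addn0; apply=> x y /and4P[Gx Gy _ /eqP cxy] Zx Zy.
  apply/esym/eq_block; first by rewrite in_setD Zx.
  by rewrite in_setD Zy in_setI Gy; apply/cent1P.
have [A bA clA]: exists2 A, A \in blocks & A \notin cl.
  apply/subsetPn; apply: contraL lecl => sbcl; rewrite -ltnNge -card_blocks.
  by rewrite cardE uniq_leq_size ?enum_uniq // => A; rewrite mem_enum => /(subsetP sbcl).
have sGA: {subset u :: s <= enum (G :\: A)}.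
  move=> x sx; rewrite mem_enum inE; have := sG x sx; rewrite /= => ->.
  rewrite andbT; apply: contra clA => Ax.
  have [y Ny defA] := imsetP bA; rewrite mem_undup defA.
  apply/mapP; exists x; last by rewrite (eq_block Ny) // -defA.
  rewrite mem_filter sx andbT.
  by move: Ax; rewrite defA => /setDP[].
have := uniq_leq_size Us sGA; rewrite -cardE cardsD.
have [y Ny defA] := imsetP bA; have sAG : A \subset G.
  by rewrite defA (subset_trans (sub_block y)) ?subsetDl.
rewrite (setIidPr sAG) oG defA card_block // /m k1 /=.
have: p ^ 2 <= p ^ 3 by rewrite leq_exp2l.
by have: p ^ 1 <= p ^ 2 by [rewrite leq_exp2l|]; lia.
Qed.

Lemma exists_noncentral : exists u, u \in N.
Proof.
have /card_gt0P[A /imsetP[u Nu _]]: 0 < #|blocks| by rewrite card_blocks.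
by exists u.
Qed.

End CentralByPSquare.

(* The subtraction is truncated, so n = 1 and n = 2 give a trivial center. *)
Lemma pgroup_small_center (gT : finGroupType) (G : {group gT}) (p n : nat) :
    prime p -> #|G| = (p ^ n)%N -> #|'Z(G)| = (p ^ (n - 2))%N ->
  n = 0%N \/ 2 < n.
Proof.
move=> p_prime oG oZ; case: n => [|n] in oG oZ *; [by left | right].
case: ltnP => // len2; have pG: p.-group G by rewrite /pgroup oG pnatX pnat_id.
have /(trivg_center_pgroup pG) G1 : 'Z(G) = 1.
  by apply: card1_trivg; rewrite oZ (eqP len2).
move: oG (prime_gt1 p_prime); rewrite G1 cards1 expnS => /esym/eqP.
by rewrite muln_eq1 => /andP[/eqP->].
Qed.

(** * Eccentricity, radius and diameter for every exponent *)

Local Open Scope nat_scope.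

Theorem theorem4p1 (gT : finGroupType) (G : {group gT}) (p n : nat)
    (p_prime : prime p) (p_odd : odd p)
    (cardG : #|G| = p ^ n) (cardZ : #|'Z(G)%g| = p ^ (n - 2)) :
  [/\ forall u : gT, u \in vertices (commuting_graph G) ->
        detour_ecc (commuting_graph G) u =
          if (n == 3) && (u \in 'Z(G)%g) then p ^ 3 - p ^ 2 + p - 1
          else p ^ n - 1,
      n = 3 ->
        detour_rad (commuting_graph G) = p ^ 3 - p ^ 2 + p - 1 /\
        detour_diam (commuting_graph G) = p ^ 3 - 1
    & 3 < n ->
        detour_rad (commuting_graph G) = p ^ n - 1 /\
        detour_diam (commuting_graph G) = p ^ n - 1].
Proof.
have ecc_G u : u \in G -> detour_ecc (commuting_graph G) u =
    if (n == 3) && (u \in 'Z(G)%g) then p ^ 3 - p ^ 2 + p - 1 else p ^ n - 1.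
  move=> Gu; have [n0|n_gt2] := pgroup_small_center p_prime cardG cardZ.
    (* For [n = 0] the group is trivial, and both sides are 0. *)
    have := @detour_ecc_le_card _ (commuting_graph G) u Gu.
    by rewrite /= cardG n0 expn0 leqn0 => /eqP.
  have def_n: n = (n - 2).+2 by lia.
  have oG := cardG; rewrite def_n in oG.
  have [Zu|nZu] := boolP (u \in 'Z(G)%g); last first.
    rewrite andbF (detour_ecc_noncentral p_prime oG cardZ) -?def_n ?subn_gt0 //.
    by rewrite in_setD nZu.
  rewrite andbT; case: eqP => [n3|n_neq3].
    apply/eqP; rewrite eqn_leq (detour_ecc_central1_le p_prime oG cardZ) ?n3 //.
    by rewrite (detour_ecc_central1_ge p_prime oG cardZ) ?n3.
  by rewrite (detour_ecc_central p_prime oG cardZ) -?def_n //; lia.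
split=> // [n3|n_gt3].
  have le_ecc: p ^ 3 - p ^ 2 + p - 1 <= p ^ 3 - 1.
    have: p ^ 2 <= p ^ 3 by rewrite leq_exp2l ?prime_gt1.
    have: p ^ 1 <= p ^ 2 by rewrite leq_exp2l ?prime_gt1.
    by lia.
  have cardG3: #|G| = p ^ 3 by rewrite cardG n3.
  have cardZ3: #|'Z(G)%g| = p ^ 1 by rewrite cardZ n3.
  have [x /setDP[Gx nZx]] := exists_noncentral p_prime cardG3 cardZ3.
  split.
    (* The radius is attained at the identity, which is central, and the diameter at the noncentral
       [x]. *)
    apply: (@detour_rad_eq _ _ 1%g); rewrite /= ?ecc_G ?group1 ?n3 // => w Gw.
    by rewrite ecc_G // n3; case: ifP.
  apply: (@detour_diam_eq _ _ x); rewrite /= ?ecc_G ?n3 ?(negPf nZx) // => w Gw.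
  by rewrite ecc_G // n3; case: ifP.
have ecc_n u : u \in G -> detour_ecc (commuting_graph G) u = p ^ n - 1.
  by move/ecc_G; case: eqP n_gt3 => // ->.
split; [apply: (@detour_rad_eq _ _ 1%g) | apply: (@detour_diam_eq _ _ 1%g)];
  by rewrite ?ecc_n ?group1 //= => w Gw; rewrite ecc_n.
Qed.
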